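(* Let $n\geq1$ and $d$ be integers with $|d|\geq2$. Then the elements $\epsilon_v$, $1\le v\le n-1$, of $\mathbb{Q}[x]/(x^n-1)$ are linearly independent over $\mathbb{Q}$, as are the elements $g_v$, $1\le v\le n-1$; and $\dim_{\mathbb{Q}}\mathcal E_{n,d}=n-1$ (dimension of the $\mathbb{Q}$-span).
   Context: In $\mathbb{Q}[x,x^{-1}]/(x^n-1)$ (so $x^a$ depends only on $a\bmod n$) put $e_v=x^v-1$, $\epsilon_v=d\,e_v-e_{dv}$, and $g_v=d\,x^v(x-1)-x^{dv}(x^d-1)$ for $v\in\mathbb{Z}_n$. $\mathcal E_{n,d}$ denotes the $\mathbb{Z}$-span of $\epsilon_1,\dots,\epsilon_{n-1}$. *)

(* Defs.v *)
From HB Require Import structures.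
From mathcomp Require Import all_boot all_order all_algebra.

Set Implicit Arguments.
Unset Strict Implicit.
Unset Printing Implicit Defensive.

Import Order.TTheory GRing.Theory Num.Theory.
Local Open Scope ring_scope.

(* {poly %/ h} is the quotient by h only when h is monic of size > 1 (it is the
   quotient by 'X otherwise); for h = 'X^n - 1 this holds as soon as 0 < n, see
   mk_monic_Xn_sub1. The class of 'X is then a unit, so that the integer powers
   qx ^ v below are genuine and 'X^-1 need not be adjoined. *)
Notation cycalg n := {poly %/ ('X^n - 1 : {poly rat})}.

Section CyclicAlgebra.

Variable n : nat.

Definition qx : cycalg n := 'qX.

(* An index v in Z_n is given by any integer representative, see qx_exp_mod. *)
Definition e_ (v : int) : cycalg n := qx ^ v - 1.

Definition epsilon (d v : int) : cycalg n := e_ v *~ d - e_ (d * v).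

Definition g_ (d v : int) : cycalg n :=
  (qx ^ v * (qx - 1)) *~ d - qx ^ (d * v) * (qx ^ d - 1).

Definition epsilons (d : int) : n.-1.-tuple (cycalg n) :=
  [tuple epsilon d (i.+1)%:Z | i < n.-1].

Definition gs (d : int) : n.-1.-tuple (cycalg n) :=
  [tuple g_ d (i.+1)%:Z | i < n.-1].

Definition calE (d : int) : cycalg n -> Prop := inIntSpan (epsilons d).

End CyclicAlgebra.

Arguments qx {n}.
Arguments e_ {n} v.

Definition is_span (K : fieldType) (vT : vectType K) (S : vT -> Prop)
    (U : {vspace vT}) : Prop :=
  forall w : vT,
    w \in U <-> exists2 s : seq vT, (forall u, u \in s -> S u) & w \in <<s>>%VS.

Lemma mk_monic_Xn_sub1 n : (0 < n)%N ->
  mk_monic ('X^n - 1 : {poly rat}) = 'X^n - 1.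
Proof.
by move=> n_gt0; rewrite /mk_monic size_XnsubC // monicXnsubC // ltnS n_gt0.
Qed.

Lemma qx_expn n : (0 < n)%N -> (qx : cycalg n) ^+ n = 1.
Proof.
move=> n_gt0; pose h : {poly rat} := 'X^n - 1.
have h0 : in_qpoly h h = 0.
  apply/val_inj; rewrite /= mk_monic_Xn_sub1 //.
  exact/Pdiv.RingMonic.rmodpp/monicXnsubC.
have XnE : 'X^n = h + 1 by rewrite subrK.
rewrite /qx /qpolyX -rmorphXn /= -/h XnE.
by rewrite in_qpolyD h0 add0r in_qpoly1.
Qed.

Lemma qx_unit n : (0 < n)%N -> (qx : cycalg n) \is a GRing.unit.
Proof. by move=> n_gt0; rewrite -(unitrX_pos _ n_gt0) qx_expn ?unitr1. Qed.

Lemma qx_exp_mod n (a : int) : (0 < n)%N ->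
  (qx : cycalg n) ^ a = qx ^ (a %% n)%Z.
Proof.
move=> n_gt0; rewrite {1}(divz_eq a n) exprzDr ?qx_unit //.
by rewrite [X in _ ^ X * _]mulrC -exprz_exp -exprnP qx_expn // exp1rz mul1r.
Qed.

(* Main.v *)
Require Import Defs.
From mathcomp Require Import all_boot all_order all_algebra.
Import Order.TTheory GRing.Theory Num.Theory.
Local Open Scope ring_scope.

(** Comparing coefficients of [x^w], [w <> 0], in a relation
    [\sum_v c_v epsilon_v = 0] gives [d c_w = \sum_(dv = w) c_v]. Summing absolute
    values over [w] yields [|d| \sum_w |c_w| <= \sum_v |c_v|], which forces
    [c = 0] since [|d| >= 2]. Next, [g_v = epsilon_(v+1) - epsilon_v] and
    [epsilon_n = 0], so by telescoping the [g_v] span every [epsilon_v]; being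
    [n - 1] vectors spanning a space of dimension at least [n - 1], they are
    independent. *)

Lemma poly_of_qx_expn n m : (m < n)%N -> ((qx : cycalg n) ^+ m : {poly rat}) = 'X^m.
Proof.
move=> lt_mn; have n_gt0 : (0 < n)%N by apply: leq_ltn_trans lt_mn.
rewrite /qx /qpolyX -rmorphXn /= Pdiv.Ring.rmodp_small // mk_monic_Xn_sub1 //.
by rewrite size_polyXn size_XnsubC.
Qed.

(** In positive degrees the constant [- 1] is invisible, and [qx ^ v] is represented by the monomial
    of degree [v %% n]. *)
Lemma coef_e_ n (v : int) (i : nat) : (0 < i < n)%N ->
  (e_ v : cycalg n)`_i = (i%:Z == (v %% n)%Z)%:R.
Proof.
case/andP=> i_gt0 lt_in; have n_gt0 : (0 < n)%N by apply: ltn_trans lt_in.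
rewrite /e_ qx_exp_mod //.
have : (0 <= v %% n)%Z by rewrite modz_ge0 // -lt0n.
have : (v %% n < n)%Z by rewrite ltz_pmod.
case: (v %% n)%Z => // m lt_mn _; rewrite -exprnP raddfB /= poly_of_qx_expn //.
rewrite coefB coefXn coefC.
by rewrite -[i == 0%N]negbK -lt0n i_gt0 subr0.
Qed.

Lemma coef_epsilon n (d v : int) (i : nat) : (0 < i < n)%N ->
  (epsilon n d v)`_i
    = d%:~R * (i%:Z == (v %% n)%Z)%:R - (i%:Z == (d * v %% n)%Z)%:R.
Proof.
move=> i_bnd; rewrite /epsilon raddfB /= raddfMz /= coefB coefMrz !coef_e_ //.
by rewrite -mulrzl.
Qed.

Lemma nth_epsilons n d (i : 'I_n.-1) : (epsilons n d)`_i = epsilon n d i.+1.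
Proof. by rewrite -tnth_nth tnth_mktuple. Qed.

Lemma nth_gs n d (i : 'I_n.-1) : (gs n d)`_i = g_ n d i.+1.
Proof. by rewrite -tnth_nth tnth_mktuple. Qed.

(** Only an upper bound is available: [z] will be a residue mod [n], possibly 0, which no [j.+1]
    matches. *)
Lemma sum_delta_le1 (m : nat) (z : int) :
  \sum_(j < m) (j.+1%:Z == z)%:R <= 1 :> rat.
Proof.
have [[j0 /eqP j0z]|no] := altP (@existsP _ (fun j : 'I_m => j.+1%:Z == z)).
  rewrite (bigD1 j0) //= j0z eqxx big1 ?addr0 // => j.
  by rewrite -j0z eqz_nat eqSS -val_eqE => /negPf->.
rewrite big1 // => j _; by move/existsPn/(_ j)/negPf: no => ->.
Qed.

Lemma epsilons_free (n : nat) (d : int) : 1 < `|d| -> free (epsilons n d).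
Proof.
move=> d_gt1; apply/freeP => k k0.
have lt_n (j : 'I_n.-1) : (j.+1 < n)%N by have := ltn_ord j; rewrite ltn_predRL.
(* Read off degree [j.+1]. Each index [i.+1] is below [n], hence its own residue, so the first term
   of [epsilon] isolates [k j]. *)
have kE j : k j * d%:~R = \sum_i k i * (j.+1%:Z == (d * i.+1 %% n)%Z)%:R.
  have /npolyP/(_ j.+1) := k0; rewrite coefn_sum coef0 => /eqP.
  under eq_bigr => i _.
    rewrite linearZ /= coefZ nth_epsilons coef_epsilon ?lt_n // mulrBr.
    rewrite modz_nat modn_small ?lt_n // eqz_nat eqSS.
    over.
  rewrite sumrB subr_eq0 => /eqP <-; rewrite (bigD1 j) //= eqxx mulr1.
  rewrite big1 ?addr0 // => i; rewrite -val_eqE eq_sym => /negPf->.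
  by rewrite !mulr0.
pose S := \sum_j `|k j|.
have S_ge0 : 0 <= S by apply: sumr_ge0.
have leS : S * `|d|%:~R <= S.
  rewrite /S mulr_suml.
  pose hits (i j : 'I_n.-1) : rat := (j.+1%:Z == (d * i.+1 %% n)%Z)%:R.
  apply: (@le_trans _ _ (\sum_j \sum_i `|k i| * hits i j)).
    apply: ler_sum => j _; rewrite intr_norm -normrM kE.
    apply: le_trans (ler_norm_sum _ _ _) _; apply: ler_sum => i _.
    by rewrite normrM normr_nat.
  (* For fixed [i] the residue of [d * i.+1] is a single number, so [k i] is counted at most
     once. *)
  rewrite exchange_big /=; apply: ler_sum => i _.
  by rewrite -mulr_sumr ler_piMr // sum_delta_le1.
have S0 : S = 0.
  apply/eqP; rewrite eq_le S_ge0 andbT leNgt; apply/negP => S_gt0.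
  by move: leS; rewrite ger_pMr // lerz1 leNgt d_gt1.
move=> j; apply/eqP; rewrite -normr_eq0; apply/eqP.
by move: j isT; apply/psumr_eq0P.
Qed.

Lemma g_E n d v : (0 < n)%N -> g_ n d v = epsilon n d (v + 1) - epsilon n d v.
Proof.
move=> /qx_unit ux; rewrite /g_ /epsilon /e_ [d * (v + 1)]mulrDr mulr1.
rewrite !exprzDr // expr1z !mulrBr !mulr1.
have subrBB (a b c : cycalg n) : a - c - (b - c) = a - b.
  by rewrite opprB addrA subrK.
have subrACA (a b c f : cycalg n) : a - b - (c - f) = a - c - (b - f).
  by rewrite opprD addrACA -opprD.
by rewrite [RHS]subrACA -mulrzBl !subrBB.
Qed.

Lemma epsilon_modulus n d : (0 < n)%N -> epsilon n d n = 0.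
Proof.
move=> n_gt0; rewrite /epsilon /e_ (qx_exp_mod (d * n)) // modzMl.
by rewrite -exprnP qx_expn // expr0z subrr mul0rz subr0.
Qed.

Lemma epsilon_in_span_gs n d v : (0 < v <= n)%N -> epsilon n d v \in <<gs n d>>%VS.
Proof.
case/andP=> v_gt0 le_vn; have n_gt0 := leq_trans v_gt0 le_vn.
(* Descending induction on [v], run on [n - v] from the vanishing case [v = n]; the bound carried
   along keeps the index positive. *)
have : (n - v < n)%N by rewrite ltn_subrL v_gt0.
rewrite -{2}(subKn le_vn); elim: (n - v)%N => {v v_gt0 le_vn} [_|k IH lt_kn].
  by rewrite subn0 epsilon_modulus // mem0v.
set v := (n - k.+1)%N; have v_gt0 : (0 < v)%N by rewrite subn_gt0.
have -> : epsilon n d v = epsilon n d (n - k)%N - g_ n d v.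
  by rewrite g_E // -PoszD addn1 subnSK ?subKr // ltnW.
rewrite memvB ?IH // 1?ltnW //.
(* The tuple starts at index 1, so [g_ n d v] sits at position [v.-1]. *)
have lt_v1 : (v.-1 < n.-1)%N by rewrite -ltnS !prednK // ltn_subrL.
have := nth_gs n d (Ordinal lt_v1); rewrite /= prednK // => <-.
by rewrite memv_span // mem_nth // size_tuple card_ord.
Qed.

Lemma gs_free (n : nat) (d : int) : (0 < n)%N -> 1 < `|d| -> free (gs n d).
Proof.
move=> n_gt0 d_gt1; rewrite /free eqn_leq dim_span size_tuple /=.
apply: (@leq_trans (\dim <<epsilons n d>>)).
  by rewrite (eqP (epsilons_free n d d_gt1)) !size_tuple.
apply/dimvS/span_subvP => _ /tnthP[i ->]; rewrite tnth_mktuple.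
by rewrite epsilon_in_span_gs //= (leq_trans (ltn_ord i)) ?leq_pred.
Qed.

(** The integer span contains the generators and lies in their rational span, so both generate the
    same rational space. *)
Lemma is_span_inIntSpan (vT : vectType rat) m (X : m.-tuple vT) :
  is_span (inIntSpan X) <<X>>%VS.
Proof.
move=> w; split=> [Xw | [s sX]].
  exists X => // u /tnthP[i ->].
  (* Indicator coefficients exhibit a generator as an integer combination. *)
  exists [ffun j => (j == i)%:Z]; rewrite (bigD1 i) //= ffunE eqxx mulr1z.
  rewrite big1 ?addr0 -?tnth_nth // => j /negPf ji.
  by rewrite ffunE ji mulr0z.
apply/subvP: w; apply/span_subvP => u /sX[a ->].
by apply: rpred_sum => i _; rewrite rpredMz // memv_span // mem_nth ?size_tuple.
Qed.

Theorem theorem2p3 (n : nat) (d : int) (hn : (1 <= n)%N) (hd : 2 <= `|d|) :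
  [/\ free (epsilons n d),
      free (gs n d)
    & exists2 U : {vspace cycalg n}, is_span (calE d) U & \dim U = n.-1].
Proof.
have eps_free := epsilons_free n d hd.
split=> //; first exact: gs_free.
exists <<epsilons n d>>%VS; first exact: is_span_inIntSpan.
by rewrite (eqP eps_free) size_tuple.
Qed.
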